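(* Let $d\in\{1,2\}$ and $m,n\in\mathbb{N}$. Let $A\in\mathbb{M}(m\times m;\mathbb{F}_d)$ and $B\in\mathbb{M}(n\times n;\mathbb{F}_d)$ be positive semidefinite and let $Z\in\mathbb{M}(m\times n;\mathbb{F}_d)$. Let $f,g:\overline{\mathbb{D}_d}\to\mathbb{F}_d$ be functions such that $f(z)=\sum_{n=1}^\infty a_nz^n$ for all $z\in\overline{\mathbb{D}_d}$, where $a_n\ge 0$ for all $n\in\mathbb{N}$, and $g(z)=\sum_{n=1}^\infty b_nz^n$ for all $z\in\overline{\mathbb{D}_d}$, where $b_n\in\mathbb{F}_d$ for all $n\in\mathbb{N}$. Assume that $|b_n|\le a_n$ for all $n\in\mathbb{N}$. If the block matrix $$\Sigma:=\begin{pmatrix}A&Z\\ Z^\ast&B\end{pmatrix}$$ is positive semidefinite, and if all of the matrices $A$, $B$ and $Z$ have entries in $\overline{\mathbb{D}_d}$, then the block matrix $$\Sigma_{f,g}:=\begin{pmatrix}f[A]&g[Z]\\ g[Z]^\ast&f[B]\end{pmatrix}$$ is also positive semidefinite. If in addition $f(r)=1$ for some $0<r\le 1$, and if $\Sigma\in C(m+n;\mathbb{F}_d)$ is a correlation matrix, then $$(r\Sigma)_{f,g}=\begin{pmatrix}f[rA]&g[rZ]\\ g[rZ]^\ast&f[rB]\end{pmatrix}\in C(m+n;\mathbb{F}_d)$$ is also a correlation matrix.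
   Context: $\mathbb{F}_1:=\mathbb{R}$, $\mathbb{F}_2:=\mathbb{C}$; $\mathbb{D}_d:=\{z\in\mathbb{F}_d:|z|<1\}$ and $\overline{\mathbb{D}_d}$ is its closure. $\mathbb{M}(m\times n;\mathbb{F})$ is the set of $m\times n$ matrices with entries in $\mathbb{F}$, and $A^\ast$ is the conjugate transpose of $A$. For a function $f$ and a matrix $A=(a_{ij})$ with entries in its domain, $f[A]:=(f(a_{ij}))$ denotes entrywise application. $C(k;\mathbb{F})$ is the set of all $k\times k$ correlation matrices over $\mathbb{F}$, i.e. positive semidefinite (in particular symmetric, respectively Hermitian) matrices with entries in $\mathbb{F}$ whose diagonal entries all equal $1$. *)

(* Defs.v *)
From HB Require Import structures.
From mathcomp Require Import all_boot all_order all_algebra.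
From mathcomp Require Import complex.
From mathcomp Require Import all_classical all_reals all_analysis.

Set Implicit Arguments.
Unset Strict Implicit.
Unset Printing Implicit Defensive.

Import Order.TTheory GRing.Theory Num.Theory.
Import numFieldNormedType.Exports.

Local Open Scope classical_set_scope.
Local Open Scope ring_scope.

(* The index d of F_d: [d1] stands for d = 1 (F_1 = R) and [d2] for d = 2
   (F_2 = C). *)
Variant field_index := d1 | d2.

(* As numFieldTypes, both fields carry their usual topology.  In R[i] the norm
   is R[i]-valued, and [x <= y] means that y - x is a nonnegative real. *)
Definition FF (R : realType) (d : field_index) : numFieldType :=
  match d with d1 => R | d2 => R[i] end.

Definition conjF (R : realType) (d : field_index) : FF R d -> FF R d :=
  match d with d1 => fun x => x | d2 => @conjc R end.

Definition adjmx (R : realType) (d : field_index) (m n : nat)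
    (A : 'M[FF R d]_(m, n)) : 'M[FF R d]_(n, m) :=
  map_mx (@conjF R d) A^T.

Definition psdmx (R : realType) (d : field_index) (n : nat)
    (A : 'M[FF R d]_n) : Prop :=
  adjmx A = A /\
  forall x : 'cV[FF R d]_n, 0 <= (adjmx x *m A *m x) ord0 ord0.

Definition corrmx (R : realType) (d : field_index) (k : nat)
    (A : 'M[FF R d]_k) : Prop :=
  psdmx A /\ forall i, A i i = 1.

Definition open_disc (R : realType) (d : field_index) : set (FF R d) :=
  [set z | `|z| < 1].

Definition closed_disc (R : realType) (d : field_index) : set (FF R d) :=
  closure (@open_disc R d).

Definition entries_in (T : Type) (D : set T) (m n : nat) (A : 'M[T]_(m, n)) :
    Prop :=
  forall i j, D (A i j).

(* h z = \sum_(n >= 1) c n * z ^ n on D; the value c 0 is irrelevant.  Only the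
   restriction of h to D is constrained. *)
Definition power_series_on (K : numFieldType) (D : set K) (h : K -> K)
    (c : nat -> K) : Prop :=
  forall z, D z ->
    (fun N : nat => \sum_(1 <= n < N) c n * z ^+ n) @ \oo --> h z.

(* Main.v *)
From HB Require Import structures.
Require Import Defs.
From mathcomp Require Import all_boot all_order all_algebra.
From mathcomp Require Import complex.
From mathcomp Require Import all_classical all_reals all_analysis.

Set Implicit Arguments.
Unset Strict Implicit.
Unset Printing Implicit Defensive.

Import Order.TTheory GRing.Theory Num.Theory.
Import numFieldNormedType.Exports.

Local Open Scope classical_set_scope.
Local Open Scope ring_scope.

(** Write Sigma = (A, Z; Z^*, B), J for an all-ones matrix of the appropriate
    size and o for the entrywise (Schur) product.  The k-th terms of the two
    power series assemble into the block matrix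

      (a_k J, b_k J; conj(b_k) J, a_k J) o Sigma^(o k).

    The first factor is positive semidefinite exactly because |b_k| <= a_k
    ([psdmx_coef_block]), and the second one is a Schur power of Sigma, so the
    Schur product theorem ([psdmx_hadamard]) makes every term, and hence every
    partial sum, positive semidefinite.  Positive semidefiniteness is preserved
    by entrywise limits ([psdmx_limit]), which gives the claim for the sums of
    the series ([psdmx_block_series]).

    The Schur product theorem is proved without square roots or a spectral
    theorem, so that the real and the complex case are one argument: splitting
    off a Schur complement writes a positive semidefinite matrix as a rank-one
    matrix plus a positive semidefinite matrix with fewer nonzero diagonal
    entries, and for a rank-one factor w w^* the Schur product with B is the
    congruence diag(w) B diag(w)^*.

    For correlation matrices, the first part is applied to r Sigma: scaling by
    r in ]0, 1] keeps Sigma positive semidefinite and its entries in the closed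
    disc, and the diagonal entries of the result are f (r * 1) = 1. *)

(** * Conjugation and adjoints over both fields *)

Lemma conjF_is_zmod_morphism (R : realType) (d : field_index) :
  zmod_morphism (@conjF R d).
Proof. by case: d => //= x y; rewrite rmorphB. Qed.

Lemma conjF_is_monoid_morphism (R : realType) (d : field_index) :
  monoid_morphism (@conjF R d).
Proof.
case: d; first by [].
by split=> [|x y] /=; [exact: (rmorph1 (@conjc R)) | exact: rmorphM].
Qed.

HB.instance Definition _ (R : realType) (d : field_index) :=
  GRing.isZmodMorphism.Build (FF R d) (FF R d) (@conjF R d)
    (@conjF_is_zmod_morphism R d).
HB.instance Definition _ (R : realType) (d : field_index) :=
  GRing.isMonoidMorphism.Build (FF R d) (FF R d) (@conjF R d)
    (@conjF_is_monoid_morphism R d).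

Lemma conjFK (R : realType) (d : field_index) : involutive (@conjF R d).
Proof. by case: d => //=; exact: conjcK. Qed.

Lemma mulr_conjF (R : realType) (d : field_index) (x : FF R d) :
  x * conjF x = `|x| ^+ 2.
Proof.
case: d x => /= x; last by rewrite normCK.
by rewrite real_normK ?num_real // expr2.
Qed.

Lemma norm_conjF (R : realType) (d : field_index) (x : FF R d) :
  `|conjF x| = `|x|.
Proof.
by apply/eqP; rewrite -(@eqrXn2 _ 2) // -!mulr_conjF conjFK mulrC.
Qed.

Lemma conjF_ge0 (R : realType) (d : field_index) (r : FF R d) :
  0 <= r -> conjF r = r.
Proof.
move=> r0; have [->|rN0] := eqVneq r 0; first exact: rmorph0.
by apply: (mulfI rN0); rewrite mulr_conjF ger0_norm.
Qed.

Lemma adjmxE (R : realType) (d : field_index) (m n : nat)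
  (A : 'M[FF R d]_(m, n)) i j : adjmx A i j = conjF (A j i).
Proof. by rewrite !mxE. Qed.

Lemma adjmxK (R : realType) (d : field_index) (m n : nat)
  (A : 'M[FF R d]_(m, n)) : adjmx (adjmx A) = A.
Proof. by apply/matrixP=> i j; rewrite !adjmxE conjFK. Qed.

Lemma adjmxM (R : realType) (d : field_index) (m n p : nat)
  (A : 'M[FF R d]_(m, n)) (B : 'M[FF R d]_(n, p)) :
  adjmx (A *m B) = adjmx B *m adjmx A.
Proof. by rewrite /adjmx trmx_mul map_mxM. Qed.

Lemma adjmxD (R : realType) (d : field_index) (m n : nat)
  (A B : 'M[FF R d]_(m, n)) : adjmx (A + B) = adjmx A + adjmx B.
Proof. by rewrite /adjmx raddfD map_mxD. Qed.

Lemma adjmxB (R : realType) (d : field_index) (m n : nat)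
  (A B : 'M[FF R d]_(m, n)) : adjmx (A - B) = adjmx A - adjmx B.
Proof. by rewrite /adjmx raddfB map_mxB. Qed.

Lemma adjmxZ (R : realType) (d : field_index) (m n : nat) (c : FF R d)
  (A : 'M[FF R d]_(m, n)) : 0 <= c -> adjmx (c *: A) = c *: adjmx A.
Proof. by move=> c0; rewrite /adjmx linearZ map_mxZ /= conjF_ge0. Qed.

(** * Positive semidefinite matrices *)

Lemma psdmx0 (R : realType) (d : field_index) (n : nat) :
  psdmx (0 : 'M[FF R d]_n).
Proof.
split=> [|x]; first by apply/matrixP=> i j; rewrite adjmxE !mxE rmorph0.
by rewrite mulmx0 mul0mx mxE.
Qed.

Lemma psdmxD (R : realType) (d : field_index) (n : nat) (A B : 'M[FF R d]_n) :
  psdmx A -> psdmx B -> psdmx (A + B).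
Proof.
move=> [hA pA] [hB pB]; split=> [|x]; first by rewrite adjmxD hA hB.
by rewrite mulmxDr mulmxDl mxE addr_ge0.
Qed.

Lemma psdmxZ (R : realType) (d : field_index) (n : nat) (c : FF R d)
  (A : 'M[FF R d]_n) : 0 <= c -> psdmx A -> psdmx (c *: A).
Proof.
move=> c0 [hA pA]; split=> [|x]; first by rewrite adjmxZ // hA.
by rewrite -scalemxAr -scalemxAl mxE mulr_ge0.
Qed.

Lemma psdmx_congr (R : realType) (d : field_index) (n p : nat)
  (A : 'M[FF R d]_n) (P : 'M[FF R d]_(n, p)) :
  psdmx A -> psdmx (adjmx P *m A *m P).
Proof.
move=> [hA pA]; split=> [|x]; first by rewrite !adjmxM adjmxK hA mulmxA.
by have := pA (P *m x); rewrite adjmxM !mulmxA.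
Qed.

Lemma psdmx_rank1 (R : realType) (d : field_index) (n : nat)
  (w : 'cV[FF R d]_n) : psdmx (w *m adjmx w).
Proof.
split=> [|x]; first by rewrite adjmxM adjmxK.
have -> : adjmx x *m (w *m adjmx w) *m x
        = adjmx (adjmx w *m x) *m (adjmx w *m x).
  by rewrite adjmxM adjmxK !mulmxA.
set y := adjmx w *m x.
by rewrite mxE big_ord1 adjmxE mulrC mulr_conjF exprn_ge0.
Qed.

Lemma psdmx_diag_ge0 (R : realType) (d : field_index) (n : nat)
  (A : 'M[FF R d]_n) i : psdmx A -> 0 <= A i i.
Proof.
move=> [_ /(_ (delta_mx i 0))].
have -> : adjmx (delta_mx i 0) = delta_mx 0 i :> 'rV[FF R d]_n.
  by apply/matrixP=> k l; rewrite adjmxE !mxE andbC rmorph_nat.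
by rewrite -rowE -colE !mxE.
Qed.

(** Test the form on x = - A_ij e_i + e_j: as the diagonal vanishes, only the
    two cross terms survive and they add up to - 2 |A_ij|^2. *)
Lemma psdmx_diag0 (R : realType) (d : field_index) (n : nat)
  (A : 'M[FF R d]_n) : psdmx A -> (forall i, A i i = 0) -> A = 0.
Proof.
move=> [hA pA] A0; apply/matrixP=> i j; rewrite [RHS]mxE.
pose x : 'cV[FF R d]_n := - A i j *: delta_mx i 0 + delta_mx j 0.
have ax : adjmx x = conjF (- A i j) *: delta_mx 0 i + delta_mx 0 j.
  apply/matrixP=> k l; rewrite adjmxE !mxE rmorphD rmorphM !rmorph_nat.
  by rewrite ![(l == _) && _]andbC.
have Aji : A j i = conjF (A i j) by rewrite -[in LHS]hA adjmxE.
have := pA x.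
rewrite ax mulmxDl -scalemxAl -!rowE mulmxDr -scalemxAr -!colE !mxE !A0 Aji.
rewrite mulr0 addr0 add0r rmorphN !mulNr [conjF _ * _]mulrC mulr_conjF.
rewrite -opprD oppr_ge0 => h.
have {}h : `|A i j| ^+ 2 <= 0.
  by apply: le_trans h; rewrite lerDl exprn_ge0.
by apply/eqP; rewrite -normr_eq0 -sqrf_eq0 eq_le h exprn_ge0.
Qed.

(** * The Schur product theorem *)

Definition hadamard (R : realType) (d : field_index) (m n : nat)
  (A B : 'M[FF R d]_(m, n)) : 'M[FF R d]_(m, n) := map2_mx *%R A B.

(** Entrywise multiplication by w w^* is the congruence by the diagonal matrix
    of w. *)
Lemma psdmx_hadamard_rank1 (R : realType) (d : field_index) (n : nat)
  (w : 'cV[FF R d]_n) (B : 'M[FF R d]_n) :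
  psdmx B -> psdmx (hadamard (w *m adjmx w) B).
Proof.
move=> pB; pose D := diag_mx (map_mx (@conjF R d) w^T).
suff -> : hadamard (w *m adjmx w) B = adjmx D *m B *m D by exact: psdmx_congr.
have -> : adjmx D = diag_mx w^T.
  rewrite /D /adjmx tr_diag_mx map_diag_mx; congr diag_mx.
  by apply/matrixP=> i j; rewrite !mxE; exact: conjFK.
rewrite mul_diag_mx mul_mx_diag; apply/matrixP=> i j.
by rewrite !mxE big_ord1 !mxE mulrAC.
Qed.

(** With e = e_i and a = A_ii = e^* A e, this is P^* A P for
    P = 1 - a^-1 e e^* A, because column i of A is A e. *)
Lemma schur_complement (R : realType) (d : field_index) (n : nat)
  (A : 'M[FF R d]_n) (i : 'I_n) : psdmx A -> A i i != 0 ->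
  psdmx (A - (A i i)^-1 *: (col i A *m adjmx (col i A))).
Proof.
move=> pA aN0; have [hA _] := pA.
pose a := A i i; pose e : 'cV[FF R d]_n := delta_mx i 0.
have ae : adjmx e = delta_mx 0 i.
  by apply/matrixP=> k l; rewrite adjmxE !mxE andbC rmorph_nat.
have a0 : 0 <= a^-1 by rewrite invr_ge0 psdmx_diag_ge0.
have ew : adjmx e *m A *m e = a%:M.
  by rewrite ae -rowE -colE; apply/matrixP=> k l; rewrite !mxE !ord1.
rewrite (colE i A) -/e -/a adjmxM hA.
pose P := 1%:M - a^-1 *: (e *m (adjmx e *m A)).
suff -> : A - a^-1 *: (A *m e *m (adjmx e *m A)) = adjmx P *m A *m P.
  exact: psdmx_congr.
have -> : adjmx P = 1%:M - a^-1 *: (A *m e *m adjmx e).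
  by rewrite /P adjmxB adjmxZ // !adjmxM adjmxK hA /adjmx trmx1 map_mx1.
rewrite mulmxBl mul1mx mulmxBr mulmx1 mulmxBl -!scalemxAl -!scalemxAr !mulmxA.
have -> : A *m e *m adjmx e *m A *m e *m adjmx e *m A
        = a *: (A *m e *m adjmx e *m A).
  have -> : A *m e *m adjmx e *m A *m e *m adjmx e *m A
          = A *m e *m (adjmx e *m A *m e) *m adjmx e *m A by rewrite !mulmxA.
  by rewrite ew mul_mx_scalar -!scalemxAl.
by rewrite [a^-1 *: (a *: _)]scalerA mulVf // scale1r subrr subr0.
Qed.

Lemma hadamardDl (R : realType) (d : field_index) (m n : nat)
  (A A' B : 'M[FF R d]_(m, n)) :
  hadamard (A + A') B = hadamard A B + hadamard A' B.
Proof. by apply/matrixP=> i j; rewrite !mxE mulrDl. Qed.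

Lemma hadamardZl (R : realType) (d : field_index) (m n : nat) (c : FF R d)
  (A B : 'M[FF R d]_(m, n)) : hadamard (c *: A) B = c *: hadamard A B.
Proof. by apply/matrixP=> i j; rewrite !mxE mulrA. Qed.

(** Induction on the number of nonzero diagonal entries of the first factor:
    subtracting the rank-one matrix of a column with a nonzero pivot kills that
    pivot, and cannot revive a zero diagonal entry, since diagonal entries only
    decrease and remain nonnegative. *)
Lemma psdmx_hadamard (R : realType) (d : field_index) (n : nat)
  (A B : 'M[FF R d]_n) : psdmx A -> psdmx B -> psdmx (hadamard A B).
Proof.
move=> pA pB.
have [k] := ubnP #|[pred i | A i i != 0]|.
elim: k A pA => // k IH A pA; rewrite ltnS => leAk.
have [i aN0 | A0] := pickP [pred i | A i i != 0]; last first.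
  rewrite (psdmx_diag0 pA); last by move=> i; apply/eqP/negbFE/A0.
  suff -> : hadamard 0 B = 0 by exact: psdmx0.
  by apply/matrixP=> i j; rewrite !mxE mul0r.
set A' := A - (A i i)^-1 *: (col i A *m adjmx (col i A)).
have pA' : psdmx A' by exact: schur_complement.
have -> : A = A' + (A i i)^-1 *: (col i A *m adjmx (col i A)).
  by rewrite subrK.
have a0 : 0 <= (A i i)^-1 by rewrite invr_ge0 psdmx_diag_ge0.
rewrite hadamardDl hadamardZl; apply: psdmxD; last first.
  exact/psdmxZ/psdmx_hadamard_rank1.
apply: IH => //; apply: leq_trans leAk; apply: proper_card.
have A'E j : A' j j = A j j - (A i i)^-1 * `|A j i| ^+ 2.
  by rewrite !mxE big_ord1 !mxE mulr_conjF.
apply/properP; split; last first.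
  exists i; first exact: aN0.
  rewrite inE /= negbK A'E ger0_norm ?psdmx_diag_ge0 //.
  by rewrite expr2 mulKf ?subrr.
apply/fintype.subsetP=> j; rewrite !inE; apply: contraNneq => Aj0.
rewrite eq_le psdmx_diag_ge0 // andbT A'E Aj0 sub0r oppr_le0.
by rewrite mulr_ge0 ?exprn_ge0.
Qed.

Lemma psdmx_const1 (R : realType) (d : field_index) (n : nat) :
  psdmx (const_mx 1 : 'M[FF R d]_n).
Proof.
suff -> : const_mx 1 = (const_mx 1 : 'cV[FF R d]_n) *m
  adjmx (const_mx 1 : 'cV[FF R d]_n).
  exact: psdmx_rank1.
by apply/matrixP=> i j; rewrite mxE mxE big_ord1 adjmxE !mxE rmorph1 mulr1.
Qed.

Lemma psdmx_hadamard_exp (R : realType) (d : field_index) (n : nat)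
  (A : 'M[FF R d]_n) (k : nat) :
  psdmx A -> psdmx (map_mx (fun z => z ^+ k) A).
Proof.
move=> pA; elim: k => [|k IH].
  suff -> : map_mx (fun z => z ^+ 0) A = const_mx 1 by exact: psdmx_const1.
  by apply/matrixP=> i j; rewrite !mxE expr0.
suff -> : map_mx (fun z => z ^+ k.+1) A
        = hadamard A (map_mx (fun z => z ^+ k) A) by exact: psdmx_hadamard.
by apply/matrixP=> i j; rewrite !mxE exprS.
Qed.

(** * The coefficient matrices of the series *)

Definition coef_block (R : realType) (d : field_index) (m n : nat)
  (s t : FF R d) : 'M[FF R d]_(m + n) :=
  block_mx (const_mx s) (const_mx t) (const_mx (conjF t)) (const_mx s).

(** Completing the square in the 2 x 2 matrix (s, t; conj(t), s) with pivot s
    yields two rank-one terms with coefficients 1/s and s - |t|^2/s, both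
    nonnegative when |t| <= s; if s = 0 then t = 0. *)
Lemma psdmx_coef_block (R : realType) (d : field_index) (m n : nat)
  (s t : FF R d) : `|t| <= s -> psdmx (@coef_block R d m n s t).
Proof.
move=> ts; have s0 : 0 <= s := le_trans (normr_ge0 t) ts.
have [sE|sN0] := eqVneq s 0.
  suff -> : @coef_block R d m n s t = 0 by exact: psdmx0.
  move: ts; rewrite sE normr_le0 => /eqP ->.
  rewrite /coef_block rmorph0; apply/matrixP=> i j.
  by rewrite !mxE; case: (fintype.split i) => k; rewrite !mxE;
    case: (fintype.split j) => l; rewrite !mxE.
pose w : 'cV[FF R d]_(m + n) := col_mx (const_mx s) (const_mx (conjF t)).
pose e : 'cV[FF R d]_(m + n) := col_mx 0 (const_mx 1).
suff -> : @coef_block R d m n s t =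
    s^-1 *: (w *m adjmx w) + (s - s^-1 * `|t| ^+ 2) *: (e *m adjmx e).
  apply: psdmxD; apply: psdmxZ; rewrite ?invr_ge0 //; try exact: psdmx_rank1.
  by rewrite subr_ge0 mulrC ler_pdivrMr ?lt_def ?sN0 // -expr2 lerXn2r ?nnegrE.
apply/matrixP=> i j; rewrite !mxE !big_ord1 !mxE.
case: (fintype.split i) => k; rewrite !mxE; case: (fintype.split j) => l;
  rewrite !mxE ?rmorph0 ?rmorph1 ?mulr0 ?mul0r ?mulr0 ?addr0 ?conjFK ?mulr1.
- by rewrite (conjF_ge0 s0) mulKf.
- by rewrite mulKf.
- by rewrite (conjF_ge0 s0) mulrCA mulVf ?mulr1.
- by rewrite [conjF t * t]mulrC mulr_conjF addrC subrK.
Qed.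

(** * Passing to the limit *)

Lemma cvg_conjF (R : realType) (d : field_index) (u : nat -> FF R d)
  (l : FF R d) : u @ \oo --> l -> (fun N => conjF (u N)) @ \oo --> conjF l.
Proof.
move=> /cvgrPdist_lt ul; apply/cvgrPdist_lt => e e0.
apply: filterS (ul e e0) => N /=.
by rewrite -rmorphB norm_conjF.
Qed.

(** In the complex case the order is only partial; the condition 0 <= x is
    closed because it is the equation |x| = x between continuous functions. *)
Lemma cvg_ge0 (K : numFieldType) (u : nat -> K) (l : K) :
  (forall N, 0 <= u N) -> u @ \oo --> l -> 0 <= l.
Proof.
move=> u0 ul; apply/normr_idP.
apply: (cvg_unique (@norm_hausdorff K K) _ ul).
by have /= := cvg_norm ul; under eq_fun do rewrite ger0_norm //; apply.
Qed.

Lemma psdmx_limit (R : realType) (d : field_index) (n : nat)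
  (T : nat -> 'M[FF R d]_n) (L : 'M[FF R d]_n) :
  (forall N, psdmx (T N)) ->
  (forall i j, (fun N => T N i j) @ \oo --> L i j) -> psdmx L.
Proof.
move=> pT TL; split=> [|x].
  apply/matrixP=> i j; rewrite adjmxE.
  apply: (cvg_unique (@norm_hausdorff (FF R d) (FF R d)) _ (TL i j)).
  suff -> : (fun N => T N i j) = (fun N => conjF (T N j i)).
    exact/cvg_conjF/TL.
  by apply/funext=> N; rewrite -adjmxE (pT N).1.
apply: (@cvg_ge0 _ (fun N => (adjmx x *m T N *m x) ord0 ord0)) => [N|].
  exact: (pT N).2.
rewrite mxE.
under eq_fun do rewrite mxE.
apply: cvg_big; first exact: add_continuous.
move=> i _; rewrite mxE; apply: cvgMr_tmp.
under eq_fun do rewrite mxE.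
apply: cvg_big; first exact: add_continuous.
by move=> j _; apply: cvgMl_tmp; exact: TL.
Qed.

(** The partial sums are entrywise sums of the terms described above; in the
    lower left block the convergence is that of the conjugate series. *)
Lemma psdmx_block_series (R : realType) (d : field_index) (m n : nat)
  (A : 'M[FF R d]_m) (B : 'M[FF R d]_n) (Z : 'M[FF R d]_(m, n))
  (f g : FF R d -> FF R d) (a b : nat -> FF R d) (D : set (FF R d)) :
  power_series_on D f a -> power_series_on D g b ->
  (forall k, (0 < k)%N -> `|b k| <= a k) ->
  psdmx (block_mx A Z (adjmx Z) B) ->
  entries_in D A -> entries_in D B -> entries_in D Z ->
  psdmx (block_mx (map_mx f A) (map_mx g Z)
                  (adjmx (map_mx g Z)) (map_mx f B)).
Proof.
move=> hf hg hab hS hA hB hZ.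
set S := block_mx A Z _ B in hS.
pose T N : 'M[FF R d]_(m + n) := \sum_(1 <= k < N)
  hadamard (@coef_block R d m n (a k) (b k)) (map_mx (fun z => z ^+ k) S).
apply: (@psdmx_limit _ _ _ T) => [N|i j].
  rewrite /T big_nat_cond; apply: (big_ind (@psdmx R d (m + n))).
  - exact: psdmx0.
  - exact: psdmxD.
  - move=> k; rewrite andbT => /andP[k0 _].
    by apply: psdmx_hadamard; [exact/psdmx_coef_block/hab
                              | exact: psdmx_hadamard_exp].
have TE N : T N i j = \sum_(1 <= k < N)
    @coef_block R d m n (a k) (b k) i j * S i j ^+ k.
  by rewrite /T summxE; apply: eq_bigr => k _; rewrite !mxE.
under eq_fun do rewrite TE.
rewrite -(splitK i) -(splitK j) /S /coef_block.
case: (fintype.split i) => k; case: (fintype.split j) => l /=;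
  rewrite ?block_mxEul ?block_mxEur ?block_mxEdl ?block_mxEdr ?adjmxE !mxE.
- under eq_fun do under eq_bigr do rewrite block_mxEul mxE.
  exact/hf/hA.
- under eq_fun do under eq_bigr do rewrite block_mxEur mxE.
  exact/hg/hZ.
- under eq_fun do under eq_bigr do
    rewrite block_mxEdl mxE -rmorphXn -rmorphM.
  under eq_fun do rewrite -rmorph_sum.
  exact/cvg_conjF/hg/hZ.
- under eq_fun do under eq_bigr do rewrite block_mxEdr mxE.
  exact/hf/hB.
Qed.

(** Multiplication by r is continuous and maps the open disc into itself, hence
    also its closure. *)
Lemma closed_disc_shrink (R : realType) (d : field_index) (r z : FF R d) :
  0 < r -> r <= 1 -> @closed_disc R d z -> @closed_disc R d (r * z).
Proof.
move=> r0 r1 hz U /mulrl_continuous /hz [w [w1 Uw]].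
exists (r * w); split=> //; rewrite /open_disc /= normrM ger0_norm ?ltW //.
by apply: le_lt_trans w1; rewrite ler_piMl.
Qed.

Theorem mainTheorem2 (R : realType) (d : field_index) (m n : nat)
  (hm : (0 < m)%N) (hn : (0 < n)%N)
  (A : 'M[FF R d]_m) (B : 'M[FF R d]_n) (Z : 'M[FF R d]_(m, n))
  (hA : psdmx A) (hB : psdmx B)
  (f g : FF R d -> FF R d) (a b : nat -> FF R d)
  (hf : power_series_on (@closed_disc R d) f a)
  (ha : forall k, (0 < k)%N -> 0 <= a k)
  (hg : power_series_on (@closed_disc R d) g b)
  (hab : forall k, (0 < k)%N -> `|b k| <= a k)
  (hS : psdmx (block_mx A Z (adjmx Z) B))
  (hAD : entries_in (@closed_disc R d) A)
  (hBD : entries_in (@closed_disc R d) B)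
  (hZD : entries_in (@closed_disc R d) Z) :
  psdmx (block_mx (map_mx f A) (map_mx g Z)
                  (adjmx (map_mx g Z)) (map_mx f B)) /\
  (forall r : FF R d, 0 < r -> r <= 1 -> f r = 1 ->
     corrmx (block_mx A Z (adjmx Z) B) ->
     corrmx (block_mx (map_mx f (r *: A)) (map_mx g (r *: Z))
                      (adjmx (map_mx g (r *: Z))) (map_mx f (r *: B)))).
Proof.
split; first exact: (psdmx_block_series hf hg hab hS).
move=> r r0 r1 fr1 [_ S1].
have shrink p q (M : 'M[FF R d]_(p, q)) :
    entries_in (@closed_disc R d) M -> entries_in (@closed_disc R d) (r *: M).
  by move=> hM i j; rewrite mxE; exact: closed_disc_shrink.
have rS : psdmx (block_mx (r *: A) (r *: Z) (adjmx (r *: Z)) (r *: B)).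
  by rewrite adjmxZ ?ltW // -scale_block_mx; apply: psdmxZ; rewrite ?ltW.
split.
  by apply: (psdmx_block_series hf hg hab rS); exact: shrink.
move=> i; have := S1 i; rewrite -(splitK i).
by case: (fintype.split i) => k /=;
  rewrite ?block_mxEul ?block_mxEdr !mxE => ->; rewrite mulr1.
Qed.
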